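(* Let $K$ be a field and let $H$ be a numerical semigroup with $\mu(I_H^* )\le\mu(I_{\widetilde H}^* )$, where $\widetilde H$ is the interval completion of $H$. Then $$\mu(I_H^* )\le\binom{\operatorname{wd}(H)+1}{2}.$$
   Context: A numerical semigroup is a subsemigroup $H\subset\mathbb{N}$ with $0\in H$ (the gcd of its elements is not required to be $1$); it has a unique minimal system of generators $a_1<\dots<a_r$ (positive integers). Its width is $\operatorname{wd}(H)=a_r-a_1$. The interval completion $\widetilde H=\langle a_1,a_1+1,a_1+2,\dots,a_r\rangle$ is the semigroup generated by all integers in the interval $[a_1,a_r]$. For a numerical semigroup $L$ with minimal generators $b_1<\dots<b_s$ and $S=K[x_1,\dots,x_s]$, $I_L\subset S$ is the kernel of the $K$-algebra map $S\to K[t]$, $x_i\mapsto t^{b_i}$. For a nonzero polynomial $f$, $f^*$ is its nonzero homogeneous component of least degree (standard grading), and $I_L^*=(f^*: f\in I_L, f\neq 0)$. For an ideal $J$, $\mu(J)$ is its minimal number of generators. *)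

(* Defs.v *)
From HB Require Import structures.
From mathcomp Require Import all_boot all_order all_algebra.
From mathcomp Require Import boolp classical_sets.
From mathcomp Require Import mpoly.

Set Implicit Arguments.
Unset Strict Implicit.
Unset Printing Implicit Defensive.

Import Order.TTheory GRing.Theory.

Local Open Scope ring_scope.
Local Open Scope classical_set_scope.

(* Neither gcd 1 (cofiniteness) nor H != {0} is required; for H = {0} the      *)
(* list of minimal generators is empty and wd H = 0.                           *)
Definition numerical_semigroup (H : set nat) : Prop :=
  H 0%N /\ forall x y : nat, H x -> H y -> H (x + y)%N.

Definition sgp_gen (A : set nat) : set nat := smallest numerical_semigroup A.

Definition is_min_gens (H : set nat) (s : seq nat) : Prop :=
  [/\ sorted ltn s, sgp_gen [set` s] = H
    & forall t : seq nat, subseq t s -> sgp_gen [set` t] = H -> t = s].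

(* The minimal generators in increasing order; for a numerical semigroup they  *)
(* exist and are unique, see min_gensP and min_gens_uniq.                      *)
Definition min_gens (H : set nat) : seq nat := xget [::] (is_min_gens H).

Definition first_gen (H : set nat) : nat := head 0%N (min_gens H).
Definition last_gen (H : set nat) : nat := last 0%N (min_gens H).

Definition wd (H : set nat) : nat := (last_gen H - first_gen H)%N.

Definition interval_completion (H : set nat) : set nat :=
  sgp_gen [set x : nat | (first_gen H <= x <= last_gen H)%N].

Definition is_ideal (R : comNzRingType) (J : set R) : Prop :=
  [/\ J 0, (forall f g, J f -> J g -> J (f + g))
    & forall c f, J f -> J (c * f)].

Definition ideal_gen (R : comNzRingType) (A : set R) : set R :=
  smallest (@is_ideal R) A.

Definition generated_by (R : comNzRingType) (J : set R) (k : nat) : Prop :=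
  exists2 s : seq R, size s = k & ideal_gen [set` s] = J.

Definition is_mu (R : comNzRingType) (J : set R) (k : nat) : Prop :=
  generated_by J k /\ forall j : nat, generated_by J j -> (k <= j)%N.

(* The default value 0 is never used for an ideal of a polynomial ring over a  *)
(* field, see muP.                                                             *)
Definition mu (R : comNzRingType) (J : set R) : nat := xget 0%N (is_mu J).

Definition toric_ideal (K : fieldType) (L : set nat) :
    set {mpoly K[size (min_gens L)]} :=
  [set f | mmap (@polyC K) (fun i => 'X^(nth 0%N (min_gens L) i)) f = 0].
Arguments toric_ideal : clear implicits.

(* Least degree of a monomial of f; all degrees are below msize f.             *)
Definition min_degree (K : fieldType) (n : nat) (f : {mpoly K[n]}) : nat :=
  \big[minn/msize f]_(m <- msupp f) mdeg m.

Definition initial_form (K : fieldType) (n : nat) (f : {mpoly K[n]}) :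
    {mpoly K[n]} :=
  pihomog mdeg (min_degree f) f.

Definition initial_ideal (K : fieldType) (n : nat) (J : set {mpoly K[n]}) :
    set {mpoly K[n]} :=
  ideal_gen [set initial_form f | f in [set f | J f /\ f != 0]].

Lemma sgp_gen_sgp (A : set nat) : numerical_semigroup (sgp_gen A).
Proof.
split=> [M [[M0 _] _] //|x y hx hy M MS]; have [[_ MD] _] := MS.
by apply: MD; [apply: hx | apply: hy].
Qed.

Lemma sub_sgp_gen (A : set nat) : A `<=` sgp_gen A.
Proof. by move=> x Ax M [_ AM]; apply: AM. Qed.

Lemma sgp_gen_min (A M : set nat) :
  numerical_semigroup M -> A `<=` M -> sgp_gen A `<=` M.
Proof. by move=> MS AM x; apply; split. Qed.

Definition atom (H : set nat) (x : nat) : Prop :=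
  [/\ H x, x != 0%N & forall y z : nat,
    H y -> H z -> y != 0%N -> z != 0%N -> x <> (y + z)%N].

Lemma sgp_muln (H : set nat) k x :
  numerical_semigroup H -> H x -> H (k * x)%N.
Proof.
move=> [H0 HD] Hx; elim: k => [|k IH]; first by rewrite mul0n.
by rewrite mulSn; apply: HD.
Qed.

Lemma atom_bound (H : set nat) :
  numerical_semigroup H -> exists N, forall x, atom H x -> (x <= N)%N.
Proof.
move=> HS; have [[a [Ha an0]]|noa] := pselect (exists a, H a /\ a != 0%N); last first.
  by exists 0%N => x [Hx xn0 _]; case: noa; exists x.
have bnd r : exists N, forall x, atom H x -> (x %% a)%N = r -> (x <= N)%N.
  have [[x [xA xr]]|nox] := pselect (exists x, atom H x /\ (x %% a)%N = r); last first.
    by exists 0%N => x xA xr; case: nox; exists x.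
  exists x => y [Hy yn0 yA] yr; rewrite leqNgt; apply/negP => ltxy.
  have [Hx xn0 _] := xA.
  have /dvdnP[k kE] : (a %| y - x)%N by rewrite -eqn_mod_dvd ?(ltnW ltxy)// xr yr.
  apply: (yA x (k * a)%N) => //; first exact: sgp_muln.
    by rewrite -kE subn_eq0 -ltnNge.
  by rewrite -kE subnKC // ltnW.
have [N NP] := choice bnd.
exists (\sum_(r < a) N r)%N => x xA.
have ltxa : (x %% a < a)%N by rewrite ltn_mod lt0n.
apply: leq_trans (NP _ x xA erefl) _.
by rewrite (bigD1 (Ordinal ltxa)) //= leq_addr.
Qed.

Lemma atom_gen (H A : set nat) x :
  numerical_semigroup H -> A `<=` H -> sgp_gen A = H -> atom H x -> A x.
Proof.
move=> [H0 HD] AH AG [Hx xn0 xA]; apply: contrapT => nAx.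
have: (H `&` [set y | y <> x]) x; last by case.
have Gx : sgp_gen A x by rewrite AG.
apply: (sgp_gen_min _ _ Gx); last first.
  by move=> y Ay; split; [exact: AH | move=> yx; apply: nAx; rewrite -yx].
split; first by split=> // x0; rewrite -x0 eqxx in xn0.
move=> y z [Hy yx] [Hz zx]; split; first exact: HD.
have [->|yn0] := eqVneq y 0%N; first by rewrite add0n.
have [->|zn0] := eqVneq z 0%N; first by rewrite addn0.
by apply/nesym/xA.
Qed.

Lemma is_min_gensP (H : set nat) : numerical_semigroup H ->
  exists s, is_min_gens H s /\ forall t, is_min_gens H t -> t = s.
Proof.
move=> HS; have [N NP] := atom_bound HS.
pose s := [seq x <- iota 0 N.+1 | `[< atom H x >]].
have sE x : x \in s <-> atom H x.
  rewrite mem_filter mem_iota /= add0n ltnS.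
  by split=> [/andP[/asboolP]//|xA]; apply/andP; split; [apply/asboolP | apply: NP].
have ss : sorted ltn s by apply: sorted_filter (iota_ltn_sorted _ _); apply: ltn_trans.
have sG : sgp_gen [set` s] = H.
  apply/seteqP; split; first by apply: sgp_gen_min => // x /= /sE[].
  have [G0 GD] := sgp_gen_sgp [set` s].
  move=> x; elim/ltn_ind: x => x IH Hx.
  have [->//|xn0] := eqVneq x 0%N.
  have [xA|nxA] := pselect (atom H x); first by apply: sub_sgp_gen; apply/sE.
  have [y [z [Hy Hz yn0 zn0 xE]]] :
      exists y z, [/\ H y, H z, y != 0%N, z != 0%N & x = (y + z)%N].
    apply: contrapT => nyz; apply: nxA; split=> // y z Hy Hz yn0 zn0 xE.
    by apply: nyz; exists y, z.
  rewrite xE; apply: GD; apply: IH => //; rewrite xE.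
    by rewrite -[ltnLHS]addn0 ltn_add2l lt0n.
  by rewrite -[ltnLHS]add0n ltn_add2r lt0n.
have sub (t : seq nat) : sgp_gen [set` t] = H -> {subset s <= t}.
  move=> tG x /sE xA; apply: (atom_gen HS _ tG xA).
  by rewrite -tG; apply: sub_sgp_gen.
have us : uniq s by apply: sorted_uniq ss; [exact: ltn_trans | exact: ltnn].
exists s; split=> [|t [st tG tM]].
  split=> // t ts tG; apply/eqP; rewrite -(size_subseq_leqif ts).
  by rewrite eqn_leq size_subseq // uniq_leq_size //; apply: sub.
apply/esym/tM => //.
have -> : s = [seq x <- t | x \in s].
  apply: (irr_sorted_eq ltn_trans ltnn) => //.
    by apply: sorted_filter => //; apply: ltn_trans.
  move=> x; rewrite mem_filter.
  by case: (boolP (x \in s)) => //= /(sub t tG) ->.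
exact: filter_subseq.
Qed.

Lemma min_gensP (H : set nat) :
  numerical_semigroup H -> is_min_gens H (min_gens H).
Proof. by move=> /is_min_gensP[s [Hs _]]; apply: xgetPex; exists s. Qed.

Lemma min_gens_uniq (H : set nat) (s : seq nat) :
  numerical_semigroup H -> is_min_gens H s -> min_gens H = s.
Proof.
move=> HS sM; have [t [_ tU]] := is_min_gensP HS.
by rewrite (tU s sM); apply/tU/min_gensP.
Qed.

Lemma ideal_gen_ideal (R : comNzRingType) (A : set R) : is_ideal (ideal_gen A).
Proof.
split=> [M [[] //]|f g hf hg M MI|c f hf M MI]; have [[_ MD MM] _] := MI.
  by apply: MD; [apply: hf | apply: hg].
by apply/MM; apply: hf.
Qed.

Lemma sub_ideal_gen (R : comNzRingType) (A : set R) : A `<=` ideal_gen A.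
Proof. by move=> x Ax M [_ AM]; apply: AM. Qed.

Lemma ideal_gen_min (R : comNzRingType) (A M : set R) :
  is_ideal M -> A `<=` M -> ideal_gen A `<=` M.
Proof. by move=> MS AM x; apply; split. Qed.

Lemma dickson (n : nat) (A : set 'X_{1..n}) :
  exists2 s : seq 'X_{1..n}, (forall m, m \in s -> A m)
    & forall m, A m -> exists2 m', m' \in s & (m' <= m)%MM.
Proof.
suff H k : exists2 s : seq 'X_{1..n}, (forall m, m \in s -> A m) & forall m, A m ->
    exists2 m', m' \in s & forall i : 'I_n, (i < k)%N -> (m' i <= m i)%N.
  have [s sA sP] := H n; exists s => // m /sP[m' m's m'P].
  by exists m' => //; apply/mnm_lepP => i; apply: m'P.
elim: k A => [|k IH] A.
  have [[m Am]|nA] := pselect (exists m, A m).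
    by exists [:: m] => [m'|m' _]; [rewrite inE => /eqP-> | exists m; rewrite ?inE].
  by exists [::] => // m Am; case: nA; exists m.
have [ltkn|lenk] := ltnP k n; last first.
  have [s sA sP] := IH A; exists s => // m /sP[m' m's m'P]; exists m' => // i _.
  by apply: m'P; apply: leq_trans lenk.
pose o := Ordinal ltkn.
have [s sA sP] := IH A.
have ex (j : nat) : exists u : seq 'X_{1..n},
    (forall m, m \in u -> A m /\ m o = j) /\ (forall m, A m -> m o = j ->
      exists2 m', m' \in u & forall i : 'I_n, (i < k)%N -> (m' i <= m i)%N).
  have [u uA uP] := IH [set m | A m /\ m o = j].
  by exists u; split=> // m Am mj; apply: uP.
have [t tP] := choice ex.
pose M := (\max_(m <- s) m o)%N.
exists (s ++ flatten [seq t j | j <- iota 0 M]) => [m|m Am].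
  rewrite mem_cat => /orP[/sA//|/flatten_mapP[j _ /(tP j).1[]]]//.
have stepP (m' : 'X_{1..n}) : (forall i : 'I_n, (i < k)%N -> (m' i <= m i)%N) ->
    (m' o <= m o)%N -> forall i : 'I_n, (i < k.+1)%N -> (m' i <= m i)%N.
  move=> lt le i; rewrite ltnS leq_eqVlt => /orP[/eqP ik|]; last exact: lt.
  by have -> : i = o by apply/val_inj.
have [ltmM|leMm] := ltnP (m o) M.
  have [m' m't m'P] := (tP (m o)).2 m Am erefl; exists m'.
    rewrite mem_cat; apply/orP; right; apply/flatten_mapP; exists (m o) => //.
    by rewrite mem_iota.
  by apply: stepP => //; rewrite ((tP _).1 _ m't).2.
have [m' m's m'P] := sP m Am; exists m'; first by rewrite mem_cat m's.
apply: stepP => //; apply: leq_trans leMm.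
by rewrite /M (big_rem m') //= leq_maxl.
Qed.

Lemma hilbert (K : fieldType) (n : nat) (J : set {mpoly K[n]}) :
  is_ideal J -> exists k, generated_by J k.
Proof.
move=> JI; have [J0 JD JM] := JI.
have [s sA sP] := dickson [set mlead f | f in [set f | J f /\ f != 0]].
have ex (m : 'X_{1..n}) : exists f : {mpoly K[n]},
    m \in s -> [/\ J f, f != 0 & mlead f = m].
  have [ms|] := boolP (m \in s); last by exists 0.
  by have [f [Jf fn0] fm] := sA m ms; exists f.
have [g gP] := choice ex.
exists (size (map g s)); exists (map g s) => //; apply/seteqP; split.
  by apply: ideal_gen_min => // f /= /mapP[m ms ->]; have [] := gP m ms.
have [G0 GD GM] := ideal_gen_ideal [set` map g s].
move=> f; elim/mleadrect: f => f IH Jf.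
have [->//|fn0] := eqVneq f 0.
have [m ms lemf] : exists2 m', m' \in s & (m' <= mlead f)%MM by apply: sP; exists f.
have [Jg gn0 gm] := gP m ms.
have Gg : ideal_gen [set` map g s] (g m) by apply: sub_ideal_gen; apply: map_f.
pose c := (mleadc f / mleadc (g m)) *: 'X_[mlead f - m] : {mpoly K[n]}.
have an0 : mleadc f / mleadc (g m) != 0.
  by rewrite mulf_neq0 ?invr_eq0 ?mleadc_eq0.
have hl : mlead (c * g m) = mlead f.
  rewrite mleadM //; last by rewrite -mleadc_eq0 mleadcZE mleadXm mcoeffX eqxx mulr1.
  by rewrite mleadZ // mleadXm gm submK.
have hc : (c * g m)@_(mlead f) = mleadc f.
  have -> : (c * g m)@_(mlead f) = (c * g m)@_(mlead f - m + m) by rewrite submK.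
  rewrite -scalerAl mcoeffZ (mulrC 'X_[_]) mcoeffMX.
  have -> : (g m)@_m = mleadc (g m) by rewrite gm.
  have gc0 : mleadc (g m) != 0 by rewrite mleadc_eq0.
  exact: (@divfK K _ gc0 _).
have Gc : ideal_gen [set` map g s] (c * g m) by apply: GM.
suff Gq : ideal_gen [set` map g s] (f - c * g m).
  by rewrite -(subrK (c * g m) f); apply: GD.
have [->//|qn0] := eqVneq (f - c * g m) 0.
apply: IH; last by rewrite -mulNr; apply: JD => //; apply: JM.
rewrite lt_neqAle; apply/andP; split; last first.
  by apply: le_trans (mleadB_le _ _) _; rewrite hl joinxx.
apply: contra qn0 => /eqP qf.
by rewrite -mleadc_eq0 qf mcoeffB hc subrr.
Qed.

Lemma muP (K : fieldType) (n : nat) (J : set {mpoly K[n]}) :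
  is_ideal J -> is_mu J (mu J).
Proof.
move=> /hilbert exk; apply: xgetPex.
have exk' : exists k, `[< generated_by J k >] by have [k ?] := exk; exists k; apply/asboolP.
case: (ex_minnP exk') => k /asboolP Jk kmin; exists k; split=> // j Jj.
by apply: kmin; apply/asboolP.
Qed.

Lemma initial_formP (K : fieldType) (n : nat) (f : {mpoly K[n]}) : f != 0 ->
  initial_form f != 0 /\
  forall d, (d < min_degree f)%N -> pihomog mdeg d f = 0.
Proof.
move=> fn0; have le m : m \in msupp f -> (min_degree f <= mdeg m)%N.
  rewrite /min_degree; elim: (msupp f : seq _) => //= x r IH; rewrite inE big_cons.
  by case/predU1P => [->|/IH]; [exact: geq_minl | apply: leq_trans (geq_minr _ _)].
split; last first.
  move=> d ltd; rewrite pihomogE big_seq_cond big1 // => m /andP[/le lem /eqP md].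
  by rewrite -md ltnNge lem in ltd.
have [m mf mdE] : exists2 m, m \in msupp f & mdeg m = min_degree f.
  suff: min_degree f = msize f \/ exists2 m, m \in msupp f & mdeg m = min_degree f.
    case=> // fE; have := le _ (mlead_supp fn0).
    by rewrite fE -(mlead_deg fn0) ltnn.
  rewrite {-2}/min_degree /min_degree big_seq; elim/big_rec: _ => [|m d mf IH]; first by left.
  by rewrite /minn; case: ifP => _ //; right; exists m.
apply/eqP => i0; move: mf; rewrite mcoeff_msupp => /eqP; apply.
have := congr1 (mcoeff m) (pihomog_partitionE (leqnn (msize f))).
rewrite raddf_sum /= => ->; apply: big1 => d _.
have [->|dn] := eqVneq (d : nat) (mdeg m); first by rewrite mdE -/(initial_form f) i0 mcoeff0.
by apply: dhomog_nemf_coeff (pihomogP mdeg d f) _; rewrite eq_sym.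
Qed.

Lemma toric_idealP (K : fieldType) (L : set nat) : is_ideal (toric_ideal K L).
Proof.
split; rewrite /toric_ideal /=; first exact: raddf0.
  by move=> f g hf hg; rewrite raddfD /= hf hg addr0.
by move=> c f hf; rewrite rmorphM /= hf mulr0.
Qed.

(* Main.v *)
Require Import Defs.
From mathcomp Require Import all_boot all_order all_algebra.
From mathcomp Require Import boolp classical_sets.
From mathcomp Require Import mpoly zify ring.

Set Implicit Arguments.
Unset Strict Implicit.
Unset Printing Implicit Defensive.

Import Order.TTheory GRing.Theory.

(* The hypothesis reduces the bound to the completion, whose minimal           *)
(* generators are [a, a+1, ..., a+w] with [w < a] and [w <= wd H]. A monomial  *)
(* of degree [d] and index sum [s] (the sum of the indices of its variables)   *)
(* maps to [t^(a d + s)]. If [f] in the toric ideal has least degree [d], a    *)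
(* term of degree [d] with [s < a] can only cancel against terms of the same   *)
(* degree and index sum, since [a d + s = a d' + s'] with [d' > d] forces      *)
(* [s >= a]. So the initial ideal is spanned by the differences of monomials   *)
(* of equal degree and index sum together with the monomials with [s >= a].    *)
(* Modulo the C(w, 2) quadrics straightening [x_i x_j], [0 < i <= j < w], every*)
(* monomial becomes [x_0^i x_w^j] or [x_0^i x_k x_w^j]; those with [s >= a] are*)
(* multiples of [x_w^q x_i], where [q w < a <= (q + 1) w], [q w + i >= a] and  *)
(* [0 < i <= w]: at most [w] further generators, and C(w, 2) + w = C(w + 1, 2).*)

Local Open Scope ring_scope.
Local Open Scope classical_set_scope.

(** * Toric kernels and components of least degree *)

(** Keeping [n] apart from the exponents [b] allows each to be rewritten on its own; in
    [toric_ideal] both come from [min_gens L], and the type depends on it. *)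
Definition toric_kernel (K : fieldType) (n : nat) (b : nat -> nat) :
    set {mpoly K[n]} :=
  [set f | mmap (@polyC K) (fun i : 'I_n => 'X^(b i)) f = 0].
Arguments toric_kernel : clear implicits.

Lemma ideal_gen0 (R : comNzRingType) (A : set R) : ideal_gen A 0.
Proof. by have [] := ideal_gen_ideal A. Qed.

Lemma ideal_sum (R : comNzRingType) (J : set R) (T : eqType) (r : seq T)
    (P : pred T) (F : T -> R) :
  is_ideal J -> (forall i, i \in r -> P i -> J (F i)) ->
  J (\sum_(i <- r | P i) F i).
Proof.
move=> [J0 JD JM] JF; rewrite big_seq_cond.
by apply: big_ind => // i /andP[ir Pi]; apply: JF.
Qed.

Lemma ideal_cong_trans (R : comNzRingType) (J : set R) g f h :
  is_ideal J -> J (f - g) -> J (g - h) -> J (f - h).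
Proof. by move=> [_ JD _] fg gh; rewrite -(subrKA g); apply: JD. Qed.

Lemma mu_le (K : fieldType) (n : nat) (J : set {mpoly K[n]}) k :
  is_ideal J -> generated_by J k -> (mu J <= k)%N.
Proof. by move=> /muP[_]; apply. Qed.

Lemma initial_form_eq (K : fieldType) (n d : nat) (f : {mpoly K[n]}) :
  f != 0 -> pihomog mdeg d f != 0 ->
  (forall e, (e < d)%N -> pihomog mdeg e f = 0) ->
  initial_form f = pihomog mdeg d f.
Proof.
move=> fn0 dn0 lt0; have [in0 min0] := initial_formP fn0.
suff <- : min_degree f = d by [].
apply/eqP; rewrite eqn_leq; apply/andP; split; rewrite leqNgt.
  by apply: contra dn0 => /min0->.
by apply: contra in0 => /lt0; rewrite /initial_form => ->.
Qed.

Lemma initial_ideal_homog (K : fieldType) (n d : nat) (J : set {mpoly K[n]}) f :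
  J f -> f \is d.-homog -> initial_ideal J f.
Proof.
move=> Jf fd; have [->|fn0] := eqVneq f 0; first exact: ideal_gen0.
apply: sub_ideal_gen; exists f => //.
rewrite (@initial_form_eq _ _ d) ?pihomog_dE// => e lted.
by rewrite (pihomog_ne0 _ fd) // gtn_eqF.
Qed.

Lemma initial_ideal_lowest (K : fieldType) (n d e : nat) (J : set {mpoly K[n]}) f g :
  J (f - g) -> f \is d.-homog -> g \is e.-homog -> (d < e)%N ->
  initial_ideal J f.
Proof.
move=> Jfg fd ge ltde; have [->|fn0] := eqVneq f 0; first exact: ideal_gen0.
have pd : pihomog mdeg d (f - g) = f.
  by rewrite raddfB /= pihomog_dE // (pihomog_ne0 _ ge) ?subr0 // gtn_eqF.
apply: sub_ideal_gen; exists (f - g).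
  by split=> //; apply: contra fn0 => /eqP fg0; rewrite -pd fg0 pihomog0.
rewrite (@initial_form_eq _ _ d) ?pd //.
  by apply: contra fn0 => /eqP fg0; rewrite -pd fg0 pihomog0.
move=> c ltcd; rewrite raddfB /= (pihomog_ne0 _ fd) ?gtn_eqF//.
by rewrite (pihomog_ne0 _ ge) ?subr0// gtn_eqF// (ltn_trans ltcd).
Qed.

Lemma coef_mmap_powers (K : fieldType) (n : nat) (b : nat -> nat)
    (f : {mpoly K[n]}) k :
  (mmap (@polyC K) (fun i : 'I_n => 'X^(b i)) f)`_k =
  \sum_(m <- msupp f | (\sum_i m i * b i)%N == k) f@_m.
Proof.
rewrite /mmap coef_sum [RHS]big_mkcond; apply: eq_bigr => m _.
rewrite coefCM.
have -> : mmap1 (fun i : 'I_n => 'X^(b i) : {poly K}) m = 'X^(\sum_i m i * b i)%N.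
  by rewrite -prodrXr; apply: eq_bigr => i _; rewrite mulnC exprM.
by rewrite coefXn eq_sym; case: eqP; rewrite (mulr1, mulr0).
Qed.

(** Constants embed into [{poly K}], so the kernel is zero. This settles [H = {0}]. *)
Lemma mu_no_variables (K : fieldType) (b : nat -> nat) :
  mu (initial_ideal (toric_kernel K 0 b)) = 0%N.
Proof.
apply/eqP; rewrite -leqn0; apply: mu_le; first exact: ideal_gen_ideal.
exists [::] => //; apply/seteqP; split; apply: ideal_gen_min.
- exact: ideal_gen_ideal.
- by [].
- exact: ideal_gen_ideal.
move=> _ [f [f0 fn0] <-]; case/negP: fn0; move: f0.
rewrite /toric_kernel /= (nvar0_mpolyC f) mmapC => /eqP.
by rewrite polyC_eq0 => /eqP ->.
Qed.

(** * Normal forms and the candidate generators *)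

Definition xvar (K : fieldType) (w k : nat) : {mpoly K[w.+1]} := 'X_(inord k).
Arguments xvar : clear implicits.

(* The monomial [1], [x_0^i x_w^j] or [x_0^i x_k x_w^j] of degree [d] and      *)
(* index sum [s]; meaningful only for [s <= d * w].                            *)
Fixpoint normal_form (K : fieldType) (w d s : nat) : {mpoly K[w.+1]} :=
  if d is e.+1 then
    if (s <= w)%N then xvar K w 0 ^+ e * xvar K w s
    else xvar K w w * normal_form K w e (s - w)
  else 1.
Arguments normal_form : clear implicits.

Lemma xvar_homog (K : fieldType) (w k : nat) : xvar K w k \is 1.-homog.
Proof. by rewrite dhomogX; apply/eqP/mdeg1. Qed.

Lemma normal_form_homog (K : fieldType) (w d s : nat) :
  normal_form K w d s \is d.-homog.
Proof.
elim: d s => [|d IH] s /=; first exact: dhomog1.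
case: ifP => _; last exact: (dhomogM (xvar_homog K w w) (IH _)).
have := dhomogM (dhomogMn d (xvar_homog K w 0)) (xvar_homog K w s).
by rewrite mul1n addn1.
Qed.

Definition quadric (K : fieldType) (w i j : nat) : {mpoly K[w.+1]} :=
  xvar K w i * xvar K w j - normal_form K w 2 (i + j).
Arguments quadric : clear implicits.

(** A product containing [x_0] or [x_w] is already in normal form, so only the pairs with
    [0 < i <= j < w] yield generators. *)
Lemma quadric_out (K : fieldType) (w i j : nat) :
  (i <= j <= w)%N -> (0 < i)%N && (j < w)%N = false -> quadric K w i j = 0.
Proof.
move=> /andP[leij lejw] out; rewrite /quadric /=.
have [i0|in0] := eqVneq i 0%N; first by rewrite i0 add0n lejw expr1 subrr.
have jw : j = w by move: out; rewrite lt0n in0 /=; lia.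
rewrite jw; case: ifP => le; first by lia.
by rewrite addnK (leq_trans leij lejw) expr0 mul1r mulrC subrr.
Qed.

Definition interval_gens (K : fieldType) (a w q : nat) : seq {mpoly K[w.+1]} :=
  [seq quadric K w i j | j <- iota 0 w, i <- iota 1 j] ++
  [seq xvar K w w ^+ q * xvar K w i | i <- iota 1 w & (a <= q * w + i)%N].
Arguments interval_gens : clear implicits.

Lemma size_interval_gens (K : fieldType) (a w q : nat) :
  (size (interval_gens K a w q) <= 'C(w.+1, 2))%N.
Proof.
rewrite size_cat size_allpairs_dep size_map binS bin1 leq_add //.
  by rewrite (eq_map (size_iota 1)) map_id -bin2_sum /index_iota subn0 sumnE.
by rewrite size_filter; apply: leq_trans (count_size _ _) _; rewrite size_iota.
Qed.

Lemma mmap_xvar (K : fieldType) (a w k : nat) : (k <= w)%N ->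
  mmap (@polyC K) (fun i : 'I_w.+1 => 'X^(a + i)) (xvar K w k) = 'X^(a + k).
Proof. by move=> lekw; rewrite mmapX mmap1U inordK. Qed.

Lemma mmap_normal_form (K : fieldType) (a w d s : nat) : (s <= d * w)%N ->
  mmap (@polyC K) (fun i : 'I_w.+1 => 'X^(a + i)) (normal_form K w d s) =
  'X^(a * d + s).
Proof.
elim: d s => [|d IH] s /= les; first by rewrite rmorph1 (_ : (a * 0 + s)%N = 0%N) //; lia.
case: ifP => lesw; rewrite rmorphM /= ?rmorphXn /= !mmap_xvar //.
  by rewrite -exprM -exprD; congr ('X^_); lia.
by rewrite IH -?exprD; [congr ('X^_)|]; lia.
Qed.

Lemma toric_kernelB (K : fieldType) (n : nat) (b : nat -> nat) (f g : {mpoly K[n]}) :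
  mmap (@polyC K) (fun i : 'I_n => 'X^(b i)) f =
    mmap (@polyC K) (fun i : 'I_n => 'X^(b i)) g ->
  toric_kernel K n b (f - g).
Proof. by move=> fg; rewrite /toric_kernel /= rmorphB /= fg subrr. Qed.

Lemma interval_gens_initial (K : fieldType) (a w q : nat) g :
  g \in interval_gens K a w q ->
  initial_ideal (toric_kernel K w.+1 (addn a)) g.
Proof.
rewrite mem_cat => /orP[/allpairsPdep[j [i [+ + ->]]]|/mapP[i + ->]].
  rewrite !mem_iota => jw ij.
  apply: (@initial_ideal_homog _ _ 2); last first.
    by rewrite rpredB ?normal_form_homog// (dhomogM (xvar_homog K w i) (xvar_homog K w j)).
  apply: toric_kernelB; rewrite mmap_normal_form ?rmorphM /= ?mmap_xvar; try lia.
  by rewrite -exprD; congr ('X^_); lia.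
rewrite mem_filter mem_iota => iP.
have hom := dhomogM (dhomogMn q (xvar_homog K w w)) (xvar_homog K w i).
(* Raising the degree by one and lowering the index sum by [a] keeps the exponent of [t]; the filter
   [a <= q * w + i] makes the subtraction exact. *)
apply: (initial_ideal_lowest _ hom (normal_form_homog K w q.+2 (q * w + i - a))); last by lia.
apply: toric_kernelB; rewrite mmap_normal_form ?rmorphM ?rmorphXn /= ?mmap_xvar; try lia.
by rewrite -exprM -exprD; congr ('X^_); lia.
Qed.

Lemma quadric_mem (K : fieldType) (a w q i j : nat) : (i <= w)%N -> (j <= w)%N ->
  ideal_gen [set` interval_gens K a w q] (quadric K w i j).
Proof.
wlog leij : i j / (i <= j)%N => [WL iw jw|iw jw].
  have [leij|/ltnW leji] := leqP i j; first exact: WL.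
  by rewrite /quadric mulrC addnC; apply: WL.
have [inn|out] := boolP ((0 < i)%N && (j < w)%N).
  apply: sub_ideal_gen; rewrite /= mem_cat; apply/orP; left.
  by apply/allpairsPdep; exists j, i; rewrite !mem_iota; split => //; lia.
rewrite quadric_out ?leij ?jw //; last exact: negbTE.
exact: ideal_gen0.
Qed.

(** * Reduction of monomials to normal form *)

Lemma normal_form_pad (K : fieldType) (w d s : nat) : (s <= 2 * w)%N ->
  xvar K w 0 ^+ d * normal_form K w 2 s = normal_form K w d.+2 s.
Proof.
move=> le2; rewrite /=; case: ifP => [_|gts]; first by rewrite expr1 mulrA -exprSr.
by rewrite ifT ?ifT; [rewrite expr0 mul1r mulrCA | lia..].
Qed.

(** Induction strips the factors [x_w]. Once [s <= w] the normal form is [x_0^d x_s], and the single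
    quadric for [x_s x_j] does the straightening. *)
Lemma xvar_normal_form (K : fieldType) (a w q j d s : nat) :
  (j <= w)%N -> (s <= d * w)%N ->
  ideal_gen [set` interval_gens K a w q]
    (xvar K w j * normal_form K w d s - normal_form K w d.+1 (s + j)).
Proof.
move=> jw; have [I0 _ IM] := ideal_gen_ideal [set` interval_gens K a w q].
elim: d s => [|d IH] s led.
  have -> : s = 0%N by lia.
  by rewrite /= jw expr0 mulr1 mul1r subrr.
have [lesw|ltws] := leqP s w.
  have -> : normal_form K w d.+1 s = xvar K w 0 ^+ d * xvar K w s by rewrite /= lesw.
  rewrite -normal_form_pad; last by lia.
  have -> : xvar K w j * (xvar K w 0 ^+ d * xvar K w s) -
      xvar K w 0 ^+ d * normal_form K w 2 (s + j) =
      xvar K w 0 ^+ d * quadric K w s j by rewrite /quadric; ring.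
  by apply: IM; apply: quadric_mem.
have -> : normal_form K w d.+1 s = xvar K w w * normal_form K w d (s - w).
  by rewrite /= leqNgt ltws.
have -> : normal_form K w d.+2 (s + j) = xvar K w w * normal_form K w d.+1 (s - w + j).
  rewrite [LHS]/= ifF; last by lia.
  by congr (_ * normal_form K w d.+1 _); lia.
by rewrite mulrCA -mulrBr; apply: IM; apply: IH; lia.
Qed.

Definition index_sum (n : nat) (m : 'X_{1..n}) : nat := (\sum_(i < n) m i * i)%N.

Lemma index_sum_le (w : nat) (m : 'X_{1..w.+1}) : (index_sum m <= mdeg m * w)%N.
Proof.
rewrite mdegE big_distrl leq_sum //= => i _.
by rewrite leq_mul2l -ltnS ltn_ord orbT.
Qed.

Lemma index_sumD (n : nat) (m1 m2 : 'X_{1..n}) :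
  index_sum (m1 + m2)%MM = (index_sum m1 + index_sum m2)%N.
Proof. by rewrite -big_split; apply: eq_bigr => i _; rewrite mnmDE mulnDl. Qed.

Lemma index_sumU (n : nat) (i : 'I_n) : index_sum U_(i)%MM = i.
Proof.
rewrite /index_sum (bigD1 i) //= mnm1E eqxx mul1n big1 ?addn0// => j ji.
by rewrite mnm1E eq_sym (negbTE ji) mul0n.
Qed.

Lemma monomial_normal_form (K : fieldType) (a w q : nat) (m : 'X_{1..w.+1}) :
  ideal_gen [set` interval_gens K a w q]
    ('X_[m] - normal_form K w (mdeg m) (index_sum m)).
Proof.
have II := ideal_gen_ideal [set` interval_gens K a w q]; have [I0 _ IM] := II.
move dE : (mdeg m) => d; elim: d m dE => [|d IH] m dE.
  have /eqP -> : m == 0%MM by rewrite -mdeg_eq0 dE.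
  by rewrite mpolyX0 subrr.
have [i mi] : exists i, (0 < m i)%N.
  apply: contrapT => no; suff : mdeg m = 0%N by rewrite dE.
  rewrite mdegE big1 // => i _; apply/eqP; rewrite -leqn0 leqNgt.
  by apply/negP => mi; apply: no; exists i.
have mE : m = (U_(i) + (m - U_(i)))%MM.
  by rewrite addmC submK //; apply/mnm_lepP => j; rewrite mnm1E; case: eqP => // <-.
move: dE; rewrite mE mdegD mdeg1 add1n => -[dE].
have xE : 'X_i = xvar K w i by rewrite /xvar inord_val.
rewrite mpolyXD xE index_sumD index_sumU addnC.
apply: (ideal_cong_trans II (g := xvar K w i * normal_form K w d (index_sum (m - U_(i))%MM))).
  by rewrite -mulrBr; apply: IM; apply: IH.
apply: xvar_normal_form; first by rewrite -ltnS.
by rewrite -dE index_sum_le.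
Qed.

(** Each factor [x_w] stripped off takes [w] from the index sum; as [q * w < s], a positive index
    sum, hence a positive degree, remains after [q] of them. *)
Lemma normal_form_shift (K : fieldType) (w q d s : nat) :
  (q * w < s)%N -> (s <= d * w)%N -> exists2 e,
    d = (q + e.+1)%N &
    normal_form K w d s = xvar K w w ^+ q * normal_form K w e.+1 (s - q * w).
Proof.
elim: q d s => [|q IH] [|d] s; try lia.
  by move=> _ _; exists d => //; rewrite expr0 mul1r subn0.
move=> lts les; have [||e dE eE] := IH d (s - w)%N; try lia.
exists e; first by rewrite dE addSn.
have -> : normal_form K w d.+1 s = xvar K w w * normal_form K w d (s - w).
  by rewrite /= ifF //; lia.
by rewrite eE exprS -mulrA mulSn subnDA.
Qed.

Lemma normal_form_mem (K : fieldType) (a w q d s : nat) :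
  (q * w < a)%N -> (a <= q.+1 * w)%N -> (a <= s)%N -> (s <= d * w)%N ->
  ideal_gen [set` interval_gens K a w q] (normal_form K w d s).
Proof.
move=> qa aq leas lesd; have [_ _ IM] := ideal_gen_ideal [set` interval_gens K a w q].
have gen i : (0 < i <= w)%N -> (a <= q * w + i)%N ->
    ideal_gen [set` interval_gens K a w q] (xvar K w w ^+ q * xvar K w i).
  move=> iw ai; apply: sub_ideal_gen; rewrite /= mem_cat; apply/orP; right.
  by apply/mapP; exists i => //; rewrite mem_filter mem_iota; lia.
have [|e _ ->] := @normal_form_shift K w q d s _ lesd; first by lia.
rewrite /=; case: ifP => lew.
  by rewrite mulrCA; apply: IM; apply: gen; lia.
(* One more [x_w] splits off, and [x_w^q x_w] is a generator because [a <= q.+1 * w]. *)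
by rewrite mulrA [_ * normal_form _ _ _ _]mulrC; apply: IM; apply: gen; lia.
Qed.

(** * The candidates generate the initial ideal *)

(** Modulo the candidates, a monomial of least degree depends only on its index sum, and vanishes if
    that is at least [a]; below [a], the coefficients sharing an index sum add up to zero. If
    [w = 0], all index sums are [0 < a]. *)
Lemma initial_form_mem (K : fieldType) (a w q : nat) f :
  (q * w < a)%N -> (a <= q.+1 * w)%N || (w == 0)%N ->
  toric_kernel K w.+1 (addn a) f ->
  ideal_gen [set` interval_gens K a w q] (initial_form f).
Proof.
move=> qa aq f0; set I := ideal_gen _.
have II : is_ideal I by apply: ideal_gen_ideal.
have [_ ID IM] := II.
have [->|fn0] := eqVneq f 0; first by rewrite /initial_form pihomog0; case: II.
have minle m : m \in msupp f -> (min_degree f <= mdeg m)%N.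
  rewrite leqNgt => mf; apply/negP => /(initial_formP fn0).2 p0.
  move: mf; rewrite mcoeff_msupp; case/eqP.
  have := congr1 (mcoeff m) (pihomog_partitionE (leqnn (msize f))).
  rewrite raddf_sum /= => ->; apply: big1 => d _.
  have [->|dn] := eqVneq (d : nat) (mdeg m); first by rewrite p0 mcoeff0.
  by apply: dhomog_nemf_coeff (pihomogP mdeg d f) _; rewrite eq_sym.
set d := min_degree f in minle.
pose R s := if (s < a)%N then normal_form K w d s else 0.
have XR m : mdeg m = d -> I ('X_[m] - R (index_sum m)).
  move=> md; have mI := @monomial_normal_form K a w q m.
  rewrite /R; case: ltnP => leas; first by rewrite -md.
  rewrite subr0 -(subrK (normal_form K w (mdeg m) (index_sum m)) 'X_[m]).
  have le := index_sum_le m.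
  by apply: ID => //; apply: normal_form_mem => //; case/orP: aq => // /eqP w0; lia.
(* Subtracting [R] changes nothing: the terms [f@_m *: R (index_sum m)] cancel within each class of
   index sum [s < a]. *)
have -> : initial_form f =
    \sum_(m <- msupp f | mdeg m == d) f@_m *: ('X_[m] - R (index_sum m)).
  rewrite /initial_form pihomogE -/d.
  apply/esym; under eq_bigr do rewrite scalerBr.
  rewrite sumrB; apply/eqP; rewrite subr_eq addrC -subr_eq subrr eq_sym; apply/eqP.
  rewrite (bigID (fun m => (index_sum m < a)%N)) /= [X in _ + X]big1 ?addr0; last first.
    by move=> m /andP[_ /negbTE sa]; rewrite /R sa scaler0.
  case: a qa aq f0 @I II ID IM R XR => [|a] qa aq f0 I II ID IM R XR; first by lia.
  rewrite (partition_big (fun m => inord (index_sum m) : 'I_a.+1) xpredT) //=.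
  apply: big1 => s _.
  have sE m : (index_sum m < a.+1)%N && (inord (index_sum m) == s) = (index_sum m == s :> nat).
    apply/andP/eqP => [[lt /eqP <-]|->]; first by rewrite inordK.
    by rewrite ltn_ord inord_val.
  transitivity ((\sum_(m <- msupp f | (mdeg m == d) && (index_sum m == s :> nat)) f@_m) *: R s).
    rewrite scaler_suml; apply: eq_big => m; first by rewrite -andbA sE.
    by rewrite -andbA sE => /andP[_ /eqP ->].
  suff -> : \sum_(m <- msupp f | (mdeg m == d) && (index_sum m == s :> nat)) f@_m = 0.
    by rewrite scale0r.
  (* This coefficient of the image of [f] is exactly the class sum: a term of degree above [d] has
     exponent at least [a.+1 * d.+1], which exceeds [a.+1 * d + s]. *)
  have := congr1 (fun p : {poly K} => p`_(a.+1 * d + s)) f0.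
  rewrite coef_mmap_powers coef0 => {2}<-.
  rewrite big_seq_cond [RHS]big_seq_cond; apply: eq_bigl => m.
  case: (boolP (m \in msupp f)) => //= /minle ledm.
  have -> : (\sum_i m i * (a.+1 + i))%N = (a.+1 * mdeg m + index_sum m)%N.
    rewrite mdegE big_distrr -big_split; apply: eq_bigr => i _ /=.
    by rewrite mulnDr mulnC.
  have lts := ltn_ord s.
  apply/andP/eqP => [[/eqP -> /eqP ->]//|eqs].
  have dE : mdeg m = d by apply/eqP; rewrite eqn_leq ledm andbT leqNgt; apply/negP => ?; nia.
  by rewrite dE eqxx; split=> //; apply/eqP; move: eqs; rewrite dE => /addnI.
apply: ideal_sum => // m _ /eqP md.
by rewrite -mul_mpolyC; apply: IM; apply: XR.
Qed.

Lemma mu_interval_le (K : fieldType) (a w : nat) : (0 < a)%N ->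
  (mu (initial_ideal (toric_kernel K w.+1 (addn a))) <= 'C(w.+1, 2))%N.
Proof.
(* For [w > 0] this is the only [q] with [q * w < a <= q.+1 * w]; for [w = 0] the quotient is
   [0]. *)
move=> a_gt0; pose q := (a.-1 %/ w)%N.
apply: leq_trans (size_interval_gens K a w q).
apply: mu_le; first exact: ideal_gen_ideal.
exists (interval_gens K a w q) => //; apply/seteqP; split.
  apply: ideal_gen_min; first exact: ideal_gen_ideal.
  by move=> g /= /interval_gens_initial.
apply: ideal_gen_min; first exact: ideal_gen_ideal.
move=> _ [f [f0 _] <-]; apply: initial_form_mem => //.
  by apply: leq_ltn_trans (leq_divM _ _) _; rewrite prednK.
have [//|w_gt0] := posnP w; first by rewrite orbT.
by rewrite orbF -(prednK a_gt0) ltn_ceil.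
Qed.

(** * Minimal generators of the interval completion *)

Lemma eq_toric_kernel (K : fieldType) (n : nat) (b c : nat -> nat) :
  (forall i, (i < n)%N -> b i = c i) -> toric_kernel K n b = toric_kernel K n c.
Proof.
move=> bc; rewrite /toric_kernel.
suff -> : (fun i : 'I_n => 'X^(b i) : {poly K}) = (fun i => 'X^(c i)) by [].
by apply: funext => i; rewrite bc.
Qed.

(** A generator [x >= 2 * a] splits as [a + (x - a)] with [x - a] again in the interval, while a sum
    of two nonzero elements is at least [2 * a]; so the minimal generators are those below
    [2 * a]. *)
Lemma min_gens_interval (a e : nat) : (0 < a)%N -> (a <= e)%N ->
  min_gens (sgp_gen [set x | (a <= x <= e)%N]) = iota a (minn (e - a) a.-1).+1.
Proof.
move=> a_gt0 leae; set A := [set x | _]; set s := iota _ _.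
have [G0 GD] := sgp_gen_sgp A.
have sA : [set` s] `<=` A by move=> x; rewrite /A /= mem_iota; lia.
have sG : sgp_gen [set` s] = sgp_gen A.
  apply/seteqP; split; apply: sgp_gen_min; try exact: sgp_gen_sgp.
    by move=> x /sA Ax; apply: sub_sgp_gen.
  have [H0 HD] := sgp_gen_sgp [set` s].
  move=> x; elim/ltn_ind: x => x IH Ax.
  have [ltx|gex] := ltnP x (2 * a).
    by apply: sub_sgp_gen; move: Ax; rewrite /A /= mem_iota; lia.
  rewrite -(subnKC (_ : (a <= x)%N)); last by lia.
  by apply: HD; apply: IH; move: Ax; rewrite /A /=; lia.
have Gge x : sgp_gen A x -> x = 0%N \/ (a <= x)%N.
  suff : sgp_gen A `<=` [set x | x = 0%N \/ (a <= x)%N] by apply.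
  apply: sgp_gen_min; last by move=> y; rewrite /A /=; lia.
  by split; [left | move=> y z /=; lia].
apply: min_gens_uniq; first exact: sgp_gen_sgp.
split; first exact: iota_ltn_sorted.
  exact: sG.
move=> t ts tG; apply/eqP; rewrite -(size_subseq_leqif ts).
rewrite eqn_leq size_subseq //; apply: uniq_leq_size => [|x xs]; first exact: iota_uniq.
have tA : [set` t] `<=` sgp_gen A by rewrite -tG; apply: sub_sgp_gen.
apply: (atom_gen (sgp_gen_sgp A) tA tG); move: (xs); rewrite mem_iota => xP.
split; first by apply: sub_sgp_gen; apply: sA.
  by lia.
by move=> y z /Gge Gy /Gge Gz; lia.
Qed.

Lemma mu_interval_semigroup_le (K : fieldType) (a e : nat) :
  (0 < a)%N -> (a <= e)%N ->
  (mu (initial_ideal (toric_ideal K (sgp_gen [set x | (a <= x <= e)%N])))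
    <= 'C((e - a).+1, 2))%N.
Proof.
move=> a_gt0 leae; set L := sgp_gen _.
rewrite -[toric_ideal K L]/(toric_kernel K _ (nth 0%N (min_gens L))).
rewrite min_gens_interval // size_iota; set w := minn _ _.
rewrite (@eq_toric_kernel K w.+1 _ (addn a)) => [|i iw]; last exact: nth_iota.
apply: leq_trans (mu_interval_le K w a_gt0) _.
by rewrite leq_bin2l // ltnS geq_minl.
Qed.

(** Dropping a generator [0] leaves the semigroup unchanged, against minimality. *)
Lemma min_gens_gt0 (H : set nat) x s :
  numerical_semigroup H -> min_gens H = x :: s -> (0 < x)%N.
Proof.
move=> HS HE; have := min_gensP HS; rewrite HE => -[_ sG sM].
rewrite lt0n; apply/eqP => x0.
have /(congr1 size)/= : s = x :: s; last by lia.
apply: sM; first exact: subseq_cons.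
rewrite -sG; apply/seteqP; split; apply: sgp_gen_min; try exact: sgp_gen_sgp.
  by move=> y ys; apply: sub_sgp_gen; rewrite /= inE; apply/orP; right.
move=> y /=; rewrite inE => /orP[/eqP ->|ys]; last exact: sub_sgp_gen.
by rewrite x0; have [] := sgp_gen_sgp [set` s].
Qed.

Theorem mainTheorem3 (K : fieldType) (H : set nat) :
  numerical_semigroup H ->
  (mu (initial_ideal (toric_ideal K H)) <=
     mu (initial_ideal (toric_ideal K (interval_completion H))))%N ->
  (mu (initial_ideal (toric_ideal K H)) <= 'C((wd H).+1, 2))%N.
Proof.
move=> HS le_mu.
have [HE|[a [s HE]]] : min_gens H = [::] \/ exists a s, min_gens H = a :: s.
  by case: (min_gens H) => [|a s]; [left | right; exists a, s].
  rewrite -[toric_ideal K H]/(toric_kernel K _ (nth 0%N (min_gens H))) HE.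
  by rewrite mu_no_variables.
apply: leq_trans le_mu _; rewrite /interval_completion /wd /first_gen /last_gen HE /=.
apply: mu_interval_semigroup_le; first exact: min_gens_gt0 HE.
have [ss _ _] := min_gensP HS; move: ss; rewrite HE /= => /(order_path_min ltn_trans).
move=> /allP as_; have := mem_last a s; rewrite inE => /orP[/eqP ->//|/as_].
exact: ltnW.
Qed.
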